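(* Let $(X,g)$ be a compact minimal system and let $h \in \tau[g]$. Then $X$ admits a partition into $\langle h\rangle$-invariant clopen subspaces (possibly empty) \[ X = X_+ \sqcup X_- \sqcup X_{\mathrm{per}}, \] where $X_+$ is the union of the positive $h$-orbits, $X_-$ is the union of the negative $h$-orbits (with respect to $g$), and $h$ has finite order on $X_{\mathrm{per}}$.
   Context: A homeomorphism $g$ of a Hausdorff space $X$ is minimal if $X\neq\emptyset$ and the only proper closed subset $K\subsetneq X$ with $gK\subseteq K$ is $K=\emptyset$. A compact minimal system $(X,g)$ is an infinite compact Hausdorff space $X$ with a minimal homeomorphism $g$ of $X$ (so $g$ is aperiodic, i.e. has no finite orbits). The topological full group $\tau[g]$ is the group of all homeomorphisms $h$ of $X$ for which there is a locally constant function $c:X\to\mathbb{Z}$ with $hx=g^{c(x)}x$ for all $x\in X$. Partial order: $x\le_g y$ iff $y=g^tx$ for some $t\ge 0$. Orbits are two-sided. For $h\in\tau[g]$, an $h$-orbit $\Omega$ is positive (with respect to $g$) if for all $y,z\in\Omega$ there is $n\in\mathbb{N}$ such that $h^{n'}y >_g z >_g h^{-n'}y$ for all $n'\ge n$; it is negative with respect to $g$ if it is positive with respect to $g^{-1}$. *)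

(* Defs.v *)
From mathcomp Require Import all_boot all_order all_algebra.
From mathcomp Require Import boolp classical_sets functions cardinality topology.

Set Implicit Arguments.
Unset Strict Implicit.
Unset Printing Implicit Defensive.

Local Open Scope classical_set_scope.

Record homeo (X : topologicalType) := Homeo {
  homeo_fun :> X -> X;
  homeo_inv : X -> X;
  homeo_funK : cancel homeo_fun homeo_inv;
  homeo_invK : cancel homeo_inv homeo_fun;
  homeo_fun_continuous : continuous homeo_fun;
  homeo_inv_continuous : continuous homeo_inv
}.

Definition homeoV (X : topologicalType) (g : homeo X) : homeo X :=
  Homeo (@homeo_invK X g) (@homeo_funK X g)
        (@homeo_inv_continuous X g) (@homeo_fun_continuous X g).

(* [Negz m] is the integer [- m.+1]. *)
Definition zpow (X : topologicalType) (g : homeo X) (n : int) : X -> X :=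
  match n with
  | Posz m => iter m g
  | Negz m => iter m.+1 (homeoV g)
  end.

Definition minimal (X : topologicalType) (g : homeo X) : Prop :=
  [set: X] !=set0 /\
  forall K : set X, closed K -> K `<` [set: X] -> g @` K `<=` K -> K = set0.

Definition compact_minimal_system (X : topologicalType) (g : homeo X) : Prop :=
  [/\ infinite_set [set: X], compact [set: X], hausdorff_space X & minimal g].

Definition locally_constant (X : topologicalType) (T : Type) (c : X -> T) :=
  forall x : X, \forall y \near x, c y = c x.

Definition topological_full_group (X : topologicalType) (g : homeo X) :
    set (homeo X) :=
  [set h | exists2 c : X -> int,
     locally_constant c & forall x, h x = zpow g (c x) x].

Definition le_orb (X : topologicalType) (g : homeo X) (x y : X) : Prop :=
  exists t : nat, y = zpow g t x.

Definition lt_orb (X : topologicalType) (g : homeo X) (x y : X) : Prop :=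
  le_orb g x y /\ x <> y.

Definition orb (X : topologicalType) (h : homeo X) (x : X) : set X :=
  range (fun n : int => zpow h n x).

Definition orbits (X : topologicalType) (h : homeo X) : set (set X) :=
  range (orb h).

Definition positive (X : topologicalType) (g h : homeo X) (O : set X) : Prop :=
  forall y z, O y -> O z -> exists n : nat, forall n' : nat, (n <= n')%N ->
    lt_orb g z (zpow h n' y) /\ lt_orb g (zpow h (- n'%:Z)%R y) z.

Definition negative (X : topologicalType) (g h : homeo X) (O : set X) : Prop :=
  positive (homeoV g) h O.

Definition union_positive (X : topologicalType) (g h : homeo X) : set X :=
  \bigcup_(O in orbits h `&` positive g h) O.

Definition union_negative (X : topologicalType) (g h : homeo X) : set X :=
  \bigcup_(O in orbits h `&` negative g h) O.

Definition cyclic_invariant (X : topologicalType) (h : homeo X) (A : set X) :=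
  forall n : int, zpow h n @` A `<=` A.

Definition finite_order_on (X : topologicalType) (h : homeo X) (A : set X) :=
  exists2 n : nat, (0 < n)%N & forall x, A x -> zpow h n x = x.

(* Main.v *)
(* On a g-orbit, identified with the integers, h is a permutation of bounded
   displacement, so both ends of an infinite h-orbit tend to +oo or -oo.  Let
   N(y) be the number of h-orbits that go from strictly below y to stay
   eventually above y, counted through their last upward crossing of y.  Each
   condition "y is not crossed again" is closed, so N is upper semicontinuous,
   and N(g y) >= N(y); hence {N >= k} is closed and forward invariant, and N is
   constant by minimality.  An infinite orbit with both ends at +oo would make N
   jump just above its minimum, so every infinite orbit is positive or negative.
   Since N is constant, the set of last crossings is moreover locally constant,
   which makes the union of the positive orbits open.  By symmetry so is the
   union of the negative ones, as is the set of periodic points: three open sets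
   that partition X. *)
Require Import Defs.
From mathcomp Require Import all_boot all_order all_algebra.
From mathcomp Require Import boolp classical_sets functions cardinality topology.
From mathcomp Require Import zify.

Set Implicit Arguments.
Unset Strict Implicit.
Unset Printing Implicit Defensive.

Import Order.TTheory GRing.Theory Num.Theory.

Local Open Scope classical_set_scope.
Local Open Scope ring_scope.

(** * Integer powers of a homeomorphism *)

Lemma zpowS (X : topologicalType) (g : homeo X) (n : int) (x : X) :
  zpow g (n + 1) x = g (zpow g n x).
Proof.
case: n => [m|[|m]].
- by have -> : Posz m + 1 = Posz m.+1 by lia.
- by have -> : Negz 0 + 1 = 0 by []; rewrite /= homeo_invK.
- have -> : Negz m.+1 + 1 = Negz m by lia.
  by rewrite /= homeo_invK.
Qed.

Lemma zpowP (X : topologicalType) (g : homeo X) (n : int) (x : X) :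
  zpow g (n - 1) x = homeoV g (zpow g n x).
Proof. by rewrite -{2}[n](subrK 1) zpowS /= homeo_funK. Qed.

Lemma zpowD (X : topologicalType) (g : homeo X) (m n : int) (x : X) :
  zpow g (m + n) x = zpow g m (zpow g n x).
Proof.
elim/int_ind: m => [|m IH|m IH]; first by rewrite add0r.
- have -> : m.+1%:Z + n = m%:Z + n + 1 by lia.
  by rewrite zpowS IH.
- have -> : - m.+1%:Z + n = - m%:Z + n - 1 by lia.
  rewrite zpowP IH -zpowP; congr (zpow g _ _); lia.
Qed.

Lemma zpow1 (X : topologicalType) (g : homeo X) (x : X) : zpow g 1 x = g x.
Proof. by []. Qed.

Lemma zpowV (X : topologicalType) (g : homeo X) (n : int) (x : X) :
  zpow (homeoV g) n x = zpow g (- n) x.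
Proof.
elim/int_ind: n => [|m IH|m IH]; first by rewrite oppr0.
- have -> : - m.+1%:Z = - m%:Z - 1 by lia.
  have -> : m.+1%:Z = m%:Z + 1 by lia.
  by rewrite zpowP -IH zpowS.
- have -> : - m.+1%:Z = - m%:Z - 1 by lia.
  rewrite zpowP IH /=; have -> : - (- m%:Z - 1) = - - m%:Z + 1 by lia.
  by rewrite zpowS.
Qed.

Lemma zpow_continuous (X : topologicalType) (g : homeo X) (n : int) :
  continuous (zpow g n).
Proof.
elim/int_ind: n => [|m IH|m IH] x; first exact: cvg_id.
- have -> : zpow g m.+1 = g \o zpow g m by [].
  by apply: continuous_comp; [exact: IH|exact: homeo_fun_continuous].
- have -> : zpow g (- m.+1%:Z) = homeo_inv g \o zpow g (- m%:Z).
    apply/funext => y; have -> : - m.+1%:Z = - m%:Z - 1 by lia.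
    by rewrite zpowP.
  by apply: continuous_comp; [exact: IH|exact: homeo_inv_continuous].
Qed.

(** * Local constancy, compactness and minimality *)

Lemma locally_constant_comp (X Y : topologicalType) (T : Type) (c : Y -> T)
    (f : X -> Y) :
  locally_constant c -> continuous f -> locally_constant (c \o f).
Proof. by move=> cl fc x; exact: (fc x _ (cl (f x))). Qed.

(** Turns local bounds by a natural number into a global one: the sets grow with [n], so compactness
    yields a common stage. They need not be open themselves. *)
Lemma compact_nat_cover {X : topologicalType} (U : nat -> set X) :
  compact [set: X] -> (forall m n x, (m <= n)%N -> U m x -> U n x) ->
  (forall x : X, exists n, \forall y \near x, U n y) ->
  exists n, forall x, U n x.
Proof.
move=> /compact_near_coveringP cX Umono Ucov.
have [|n Un] := filter_ex (cX nat \oo U _ _); last first.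
  by exists n => x; exact: Un.
move=> x _; have [n Un] := Ucov x.
exists ([set y | U n y], [set k | (n <= k)%N]); first by split=> //; exists n.
by move=> [y k] /= [Uy nk]; exact: Umono nk Uy.
Qed.

Lemma locally_constant_bounded (X : topologicalType) (c : X -> int) :
  compact [set: X] -> locally_constant c ->
  exists M : nat, forall x, (`|c x|%N <= M)%N.
Proof.
move=> cX cl; apply: compact_nat_cover => //.
  by move=> m n x mn /leq_trans; exact.
move=> x; exists `|c x|%N; near=> y.
by have -> : c y = c x by near: y; exact: cl.
Unshelve. all: by end_near. Qed.

(** Minimality speaks of forward invariance only, so inverting [g] uses compactness. If [K] is
    invariant under the inverse, the points whose whole forward orbit stays in [K] form a closed
    forward invariant set, hence an empty one. The preimages of [K] under the powers of [g] decrease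
    to it, so one of them is empty, and [K] with it. *)
Lemma compact_minimal_systemV (X : topologicalType) (g : homeo X) :
  compact_minimal_system g -> compact_minimal_system (homeoV g).
Proof.
case=> infX cX hX [X0 gmin]; split=> //; split=> // K Kcl Kproper KV.
have KVn n x : K x -> K (zpow g (- n%:Z) x).
  move=> Kx; elim: n => [//|n IH].
  have -> : - n.+1%:Z = - n%:Z - 1 by lia.
  by rewrite zpowP; apply: KV; exists (zpow g (- n%:Z) x).
pose K0 := \bigcap_(n in [set: nat]) (zpow g n%:Z @^-1` K).
have K00 : K0 = set0.
  apply: gmin.
  - apply: closed_bigI => n _; apply: (continuous_closedP _).1 => // x.
    exact: zpow_continuous.
  - split=> [//|sub]; apply: Kproper.2 => x _; exact: (sub x I 0%N I).
  - move=> _ [x K0x <-] n _ /=.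
    have := K0x n.+1 I; rewrite /= -iterS iterSr //.
apply/seteqP; split=> // x Kx.
have [] := @compact_nat_cover X (fun n => ~` (zpow g n%:Z @^-1` K)) cX.
- move=> m n y mn /= mK nK; apply: mK.
  have := KVn (n - m)%N _ nK; rewrite -[iter n g y]/(zpow g n y) -zpowD.
  by have -> : - (n - m)%N%:Z + n%:Z = m by lia.
- move=> y; have : ~ K0 y by rewrite K00.
  move=> /existsNP[n /not_implyP[_ nK]]; exists n.
  apply: open_nbhs_nbhs; split=> //; apply: closed_openC.
  by apply: (continuous_closedP _).1 => // z; exact: zpow_continuous.
- move=> n /(_ (zpow g (- n%:Z) x)) []; rewrite /= -[iter n g _]/(zpow g n _).
  by rewrite -zpowD subrr.
Qed.

(** A coincidence would give a finite forward orbit, which is closed, forward invariant, and proper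
    because [X] is infinite. *)
Lemma minimal_aperiodic {X : topologicalType} {g : homeo X} :
  compact_minimal_system g -> forall x, injective ((zpow g)^~ x).
Proof.
move=> [infX cX hX [X0 gmin]].
have aper n x : zpow g n.+1 x <> x.
  move=> gx; pose K := (fun i : nat => zpow g i x) @` `I_n.+1.
  have Kfin : finite_set K by apply: finite_image; exact: finite_II.
  have K0 : K x by exists 0%N.
  have : K <> set0 by move=> K0'; rewrite K0' in K0.
  apply; apply: gmin.
  - by apply: (accessible_finite_set_closed.1 (hausdorff_accessible hX)).
  - split=> // sub; apply: infX; exact: sub_finite_set sub Kfin.
  - move=> _ [_ [i /= lein <-] <-]; have [->|ne] := eqVneq i n.
      by exists 0%N => //=; rewrite -[RHS]gx.
    by exists i.+1 => //=; lia.
move=> x; suff wlog m n : m < n -> zpow g m x <> zpow g n x.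
  by move=> m n /= e; case: (ltgtP m n) => // /wlog; rewrite e.
move=> mn e; apply: (aper `|n - m|.-1%N (zpow g m x)).
by rewrite -zpowD e; congr (zpow g _ _); lia.
Qed.

Lemma topological_full_groupVl (X : topologicalType) (g h : homeo X) :
  topological_full_group g h -> topological_full_group (homeoV g) h.
Proof.
move=> [c cl hc]; exists (fun x => - c x).
  by move=> x; near do rewrite (near (cl x)) //.
by move=> x; rewrite zpowV opprK.
Unshelve. all: by end_near. Qed.

Lemma topological_full_groupVr (X : topologicalType) (g h : homeo X) :
  topological_full_group g h -> topological_full_group g (homeoV h).
Proof.
move=> [c cl hc]; exists (fun x => - c (homeoV h x)).
  have := locally_constant_comp cl (@homeo_inv_continuous _ h).
  by move=> dl x; apply: filterS (dl x) => y /= ->.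
by move=> x; rewrite -{3}[x](homeo_invK h) hc -zpowD addNr.
Qed.


(* The forward [h]-orbit of [x] tends to [+oo] along the [g]-orbit. *)
Definition escapes (X : topologicalType) (g h : homeo X) (x : X) : Prop :=
  forall p : int, exists N : nat, forall n, (N <= n)%N ->
    exists2 t, p <= t & iter n h x = zpow g t x.

(** * Divergence and minima of integer sequences *)

Lemma near_all_seq (X : topologicalType) (T : eqType) (s : seq T)
    (Q : T -> X -> Prop) (x : X) :
  (forall i, i \in s -> \forall y \near x, Q i y) ->
  \forall y \near x, forall i, i \in s -> Q i y.
Proof.
elim: s => [|a s IH] Qs; first by near=> y.
have Qa := Qs a (mem_head a s).
have Qt := IH (fun i si => Qs i (mem_behead (s := a :: s) si)).
near=> y => i; rewrite inE => /predU1P[->|si].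
  by near: y.
by move: i si; near: y.
Unshelve. all: by end_near. Qed.

Lemma injective_seq_avoid (u : nat -> int) (B : nat) : injective u ->
  exists N : nat, forall n, (N <= n)%N -> (B < `|u n|)%N.
Proof.
move=> uinj.
have avoid v : exists N : nat, forall n, (N <= n)%N -> u n <> v.
  have [[n0 <-]|nv] := pselect (exists n, u n = v).
    by exists n0.+1 => n ltn /uinj e; rewrite e ltnn in ltn.
  by exists 0%N => n _ e; apply: nv; exists n.
elim: B => [|B [N IH]].
  by have [N uN] := avoid 0; exists N => n /uN; lia.
have [N1 u1] := avoid B.+1%:Z; have [N2 u2] := avoid (- B.+1%:Z).
exists (maxn N (maxn N1 N2)) => n; rewrite !geq_max => /and3P[/IH ? /u1 ? /u2 ?].
lia.
Qed.

(** Once [u] stays outside [-M, M], steps of size at most [M] cannot change its sign, so the sign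
    decides the limit. *)
Lemma bounded_steps_diverge (u : nat -> int) (M : nat) : injective u ->
  (forall n, (`|u n.+1 - u n| <= M)%N) ->
  (forall p : int, exists N : nat, forall n, (N <= n)%N -> p <= u n) \/
  (forall p : int, exists N : nat, forall n, (N <= n)%N -> u n <= p).
Proof.
move=> uinj ustep; have [N uN] := injective_seq_avoid M uinj.
have [pos|neg] := leP 0 (u N); [left|right] => p;
    have [N' uN'] := injective_seq_avoid `|p|%N uinj.
- have pos' k : 0 <= u (N + k)%N.
    elim: k => [|k IH]; first by rewrite addn0.
    have := uN (N + k)%N (leq_addr _ _); have := ustep (N + k)%N.
    rewrite addnS; lia.
  exists (maxn N N') => n; rewrite geq_max => /andP[Nn /uN'].
  have := pos' (n - N)%N; rewrite subnKC //; lia.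
- have neg' k : u (N + k)%N < 0.
    elim: k => [|k IH]; first by rewrite addn0.
    have := uN (N + k)%N (leq_addr _ _); have := ustep (N + k)%N.
    rewrite addnS; lia.
  exists (maxn N N') => n; rewrite geq_max => /andP[Nn /uN'].
  have := neg' (n - N)%N; rewrite subnKC //; lia.
Qed.

Lemma int_minimum (Q : int -> Prop) (b k : int) : Q k ->
  (forall j, Q j -> b <= j) -> exists2 m, Q m & forall j, Q j -> m <= j.
Proof.
move=> Qk Qb; pose R (n : nat) := `[< Q (b + n%:Z) >].
have exR : exists n, R n.
  exists `|k - b|%N; apply/asboolP.
  by have -> : b + `|k - b|%N%:Z = k by have := Qb _ Qk; lia.
exists (b + (ex_minn exR)%:Z); case: ex_minnP => n /asboolP Qn nmin //.
move=> j Qj; have bj := Qb _ Qj; suff : (n <= `|j - b|)%N by lia.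
apply: nmin; apply/asboolP.
by have -> : b + `|j - b|%N%:Z = j by lia.
Qed.

Lemma eventually_ge0_bounded_below (u : nat -> int) (N : nat) :
  (forall n, (N <= n)%N -> 0 <= u n) -> exists b, forall n, b <= u n.
Proof.
elim: N => [|N IH] uN; first by exists 0 => n; exact: uN.
have [uN0|uN0] := leP 0 (u N).
  apply: IH => n; rewrite leq_eqVlt => /predU1P[<- //|]; exact: uN.
exists (\big[Order.min/0]_(i < N.+1) u i) => n.
have [nN|Nn] := leqP n N; first exact: (bigmin_le _ (Ordinal (nN : (n < N.+1)%N))).
by apply: le_trans (uN _ Nn); exact: bigmin_le_id.
Qed.

(** * Periodic points *)

Lemma iter_period (T : Type) (f : T -> T) (n k : nat) (x : T) :
  iter n f x = x -> iter (k * n) f x = x.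
Proof. by move=> e; elim: k => //= k IH; rewrite mulSn iterD IH. Qed.

Lemma iter_homeoK (X : topologicalType) (h : homeo X) (n : nat) :
  cancel (iter n h) (iter n (homeoV h)).
Proof.
by elim: n => [//|n IH] x; rewrite iterSr /= homeo_funK IH.
Qed.

Lemma iter_homeo_inj (X : topologicalType) (h : homeo X) (n : nat) :
  injective (iter n h).
Proof. exact: can_inj (iter_homeoK h n). Qed.

Definition periodic (X : topologicalType) (h : homeo X) (x : X) : Prop :=
  exists n, iter n.+1 h x = x.

Lemma periodic_iter (X : topologicalType) (h : homeo X) n x :
  periodic h (iter n h x) <-> periodic h x.
Proof.
split=> -[m e]; exists m; last by rewrite -iterD addnC iterD e.
by apply: (@iter_homeo_inj _ h n); rewrite -iterD addnC iterD.
Qed.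

Lemma periodic_zpow (X : topologicalType) (h : homeo X) (n : int) x :
  periodic h (zpow h n x) <-> periodic h x.
Proof.
suff per m y : periodic h y -> periodic h (zpow h m y).
  split=> [/(per (- n))|]; last exact: per.
  by rewrite -zpowD addNr.
move=> [k e]; exists k; change (zpow h k.+1 (zpow h m y) = zpow h m y).
by rewrite -zpowD addrC zpowD; congr (zpow h m _).
Qed.

(** * The cocycle of [h] along the orbits of [g] *)

Section Cocycle.
Variables (X : topologicalType) (g h : homeo X) (c : X -> int).
Hypotheses (gmin : compact_minimal_system g) (cl : locally_constant c).
Hypothesis hc : forall x, h x = zpow g (c x) x.

(** [d] is the cocycle of the inverse of [h], and [s n] that of the [n]-th iterate: signed
    displacements along the [g]-orbit. *)
Let d (x : X) : int := - c (homeoV h x).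
Let s (n : nat) (x : X) : int := \sum_(i < n) c (iter i h x).

Let ginj : forall x, injective ((zpow g)^~ x) := minimal_aperiodic gmin.

Lemma iter_cocycle n x : iter n h x = zpow g (s n x) x.
Proof.
elim: n => [|n IH]; first by rewrite /s big_ord0.
by rewrite iterS hc {2}IH -zpowD /s big_ord_recr addrC.
Qed.

Let s0 x : s 0 x = 0.
Proof. by rewrite /s big_ord0. Qed.

Let s1 x : s 1 x = c x.
Proof. by rewrite /s big_ord1. Qed.

Let sD m n x : s (m + n) x = s n x + s m (iter n h x).
Proof.
by apply: (@ginj x); rewrite addrC zpowD -!iter_cocycle -iterD.
Qed.

Let hd x : homeoV h x = zpow g (d x) x.
Proof.
rewrite /d; move: (homeoV h x) (homeo_invK h x : h (homeoV h x) = x) => y <-.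
by rewrite hc -zpowD addNr. Qed.

Let dh x : d (h x) = - c x.
Proof. by rewrite /d /= homeo_funK. Qed.

Let s_loc n : locally_constant (s n).
Proof.
elim: n => [|n IH] x; first by near=> y; rewrite !s0.
have hcont : continuous (iter n h).
  by elim: {IH} n => [|n IH] z; [exact: cvg_id|
    exact: (continuous_comp (IH z) (@homeo_fun_continuous _ h _))].
have cn := locally_constant_comp cl hcont x.
near=> y; rewrite /s !big_ord_recr -/(s n y) -/(s n x) /=.
by congr (_ + _); near: y; [exact: IH|exact: cn].
Unshelve. all: by end_near. Qed.

Let d_loc : locally_constant d.
Proof.
move=> x; have := locally_constant_comp cl (@homeo_inv_continuous _ h) x.
by apply: filterS => y /= e; rewrite /d /= e.
Qed.

Lemma s_inj x : ~ periodic h x -> injective (s^~ x).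
Proof.
move=> nper; suff wlog m n : (m < n)%N -> s m x <> s n x.
  by move=> m n /= e; case: (ltngtP m n) => // /wlog; rewrite e.
move=> mn e; apply: nper; exists (n - m).-1.
have : s (n - m) (iter m h x) = 0.
  by have := sD (n - m) m x; rewrite subnK; [lia|exact: ltnW].
move=> e0; apply: (@iter_homeo_inj _ h m).
have -> : (n - m).-1.+1 = (n - m)%N by lia.
by rewrite -iterD addnC iterD iter_cocycle e0.
Qed.

Lemma escapes_cocycle x :
  escapes g h x <->
  forall p, exists N : nat, forall n, (N <= n)%N -> p <= s n x.
Proof.
split=> esc p; have [N Nesc] := esc p; exists N => n /Nesc.
  by move=> [t pt]; rewrite iter_cocycle => /ginj ->.
by move=> ps; exists (s n x) => //; exact: iter_cocycle.
Qed.

Lemma escapesV_cocycle x :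
  escapes (homeoV g) h x <->
  forall p, exists N : nat, forall n, (N <= n)%N -> s n x <= p.
Proof.
split=> esc p; have [N Nesc] := esc (- p); exists N => n /Nesc.
  by move=> [t pt]; rewrite iter_cocycle zpowV => /ginj ->; lia.
by move=> ps; exists (- s n x); [lia|rewrite zpowV opprK; exact: iter_cocycle].
Qed.

(** * Last upward crossings, their number, and consequences *)

Variable M : nat.
Hypothesis cM : forall x, (`|c x| <= M)%N.

Lemma aperiodic_escapes x : ~ periodic h x ->
  escapes g h x \/ escapes (homeoV g) h x.
Proof.
move=> nper; have [] := @bounded_steps_diverge (s^~ x) M (s_inj nper).
- by move=> n; have := sD 1 n x; rewrite add1n s1 => ->; rewrite addrC addKr.
- by move=> esc; left; exact/escapes_cocycle.
- by move=> esc; right; exact/escapesV_cocycle.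
Qed.

(* [g^j y] is the first point of its [h]-orbit after the last upward crossing of
   the level [g^p y]. *)
Definition last_crossing (p : int) (y : X) (j : int) : Prop :=
  j + d (zpow g j y) < p /\ forall n, p <= j + s n (zpow g j y).

(** With period [n + 1], the [n]-th iterate would be the predecessor, which is below level [p],
    unlike all forward iterates. *)
Lemma last_crossing_aperiodic p y j :
  last_crossing p y j -> ~ periodic h (zpow g j y).
Proof.
move=> [jd js] [n]; set z := zpow g j y in jd js * => e.
have := js n; suff -> : s n z = d z by lia.
apply: (@ginj z); rewrite -iter_cocycle -hd /=.
by apply: (can_inj (@homeo_funK _ h)); rewrite homeo_invK.
Qed.

(** Of two distinct last crossings on one [h]-orbit, the later has a predecessor below 0 that is a
    forward iterate of the earlier, hence not below 0. *)
Lemma last_crossing_unique y j j' m m' :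
  last_crossing 0 y j -> last_crossing 0 y j' ->
  iter m h (zpow g j y) = iter m' h (zpow g j' y) -> j = j'.
Proof.
suff wlog i i' k k' : (k <= k')%N ->
    last_crossing 0 y i -> last_crossing 0 y i' ->
    iter k h (zpow g i y) = iter k' h (zpow g i' y) -> i = i'.
  move=> Lj Lj' e; case: (leqP m m') => [mm'|/ltnW mm'].
    exact: wlog mm' Lj Lj' e.
  by apply/esym; exact: wlog mm' Lj' Lj (esym e).
move=> kk' Li Li'; rewrite -(subnKC kk') iterD => /iter_homeo_inj.
case: (k' - k)%N => [|q] e; first exact: (@ginj y).
have /(@ginj y) : zpow g (d (zpow g i y) + i) y =
    zpow g (s q (zpow g i' y) + i') y.
  by rewrite !zpowD -hd -iter_cocycle e /= homeo_funK.
by have := Li.1; have := Li'.2 q; lia.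
Qed.

(** Aperiodicity forbids a return to [y], so from [h y] on the orbit stays at level 1 or above,
    while the predecessor [y] is at 0. *)
Lemma last_crossing_from_min y : ~ periodic h y -> (forall n, 0 <= s n y) ->
  last_crossing 1 y (c y).
Proof.
move=> nper y0; split; rewrite -hc; first by rewrite dh; lia.
move=> n; have := sD n 1 y; rewrite addn1 s1 /= => <-.
have /eqP : s n.+1 y <> s 0 y by move/(s_inj nper).
by have := y0 n.+1; rewrite s0; lia.
Qed.

Lemma last_crossing_hit y j m : last_crossing 0 y j ->
  iter m h (zpow g j y) = y -> last_crossing 1 y (c y).
Proof.
move=> Lj e; apply: last_crossing_from_min.
  by rewrite -e => /periodic_iter; exact: last_crossing_aperiodic Lj.
move=> n; have := Lj.2 (n + m)%N; rewrite sD e.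
suff : s m (zpow g j y) + j = 0 by lia.
by apply: (@ginj y); rewrite zpowD -iter_cocycle.
Qed.

(** The only point at level 0 is [y], so an orbit that stays at 0 or above and avoids [y] stays at 1
    or above. *)
Lemma last_crossing_nohit y j : last_crossing 0 y j ->
  ~ (exists m, iter m h (zpow g j y) = y) -> last_crossing 1 y j.
Proof.
move=> [jd js] nhit; split=> [|n]; first lia.
suff /eqP : j + s n (zpow g j y) <> 0 by have := js n; lia.
by move=> e; apply: nhit; exists n; rewrite iter_cocycle -zpowD addrC e.
Qed.

Lemma last_crossing_shift y j :
  last_crossing 0 (g y) j <-> last_crossing 1 y (j + 1).
Proof.
rewrite /last_crossing zpowD zpow1; split=> -[jd js].
  by split=> [|n]; [|have := js n]; lia.
by split=> [|n]; [|have := js n]; lia.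
Qed.

(** Searching 0, ..., M - 1 loses nothing: a last crossing of level 0 is nonnegative and one step of
    length at most [M] above a negative level. *)
Definition crossings (y : X) : seq int :=
  [seq j <- map Posz (iota 0 M) | `[< last_crossing 0 y j >]].

Lemma mem_crossings y j : (j \in crossings y) = `[< last_crossing 0 y j >].
Proof.
rewrite mem_filter; case: asboolP => //= -[jd js].
have j0 := js 0%N; rewrite s0 addr0 in j0.
apply/mapP; exists `|j|%N; last by lia.
rewrite mem_iota /=; move: jd; rewrite /d.
have := cM (homeoV h (zpow g j y)); lia.
Qed.

Lemma crossings_uniq y : uniq (crossings y).
Proof.
by apply: filter_uniq; rewrite map_inj_uniq ?iota_uniq // => i j [].
Qed.

(* Passing from [y] to [g y] replaces the last crossing of the only orbit that
   comes back to [y] after it, if there is one, by [h y]. *)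
Lemma size_crossings_le y : (size (crossings y) <= size (crossings (g y)))%N.
Proof.
pose hit j := exists m, iter m h (zpow g j y) = y.
pose f j := (if `[< hit j >] then c y else j) - 1.
rewrite -(size_map f); apply: uniq_leq_size.
  rewrite map_inj_in_uniq ?crossings_uniq // => i j.
  rewrite !mem_crossings => /asboolP Li /asboolP Lj /addIr.
  (* The predecessor of [h y] is [y], at level 0, so [c y] is not a last crossing of 0; hence
     replaced and kept indices do not collide. *)
  have chit k : last_crossing 0 y k -> c y <> k.
    by move=> [kd _] e; move: kd; rewrite -e -hc dh; lia.
  case: asboolP => [[m ei]|_]; case: asboolP => [[m' ej]|_] //.
  - by move=> _; exact: last_crossing_unique Li Lj (etrans ei (esym ej)).
  - by move/(chit _ Lj).
  - by move/esym/(chit _ Li).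
move=> _ /mapP[j /[!mem_crossings] /asboolP Lj ->].
apply/asboolP/last_crossing_shift; rewrite /f subrK.
case: asboolP => [[m e]|nhit]; first exact: last_crossing_hit Lj e.
exact: last_crossing_nohit.
Qed.

(** Failing to be a last crossing is witnessed by [d] or by a single [s n], both locally constant,
    so it persists nearby; finitely many candidates share a neighbourhood. *)
Lemma near_crossings_sub x :
  \forall y \near x, {subset crossings y <= crossings x}.
Proof.
pose Q j y := last_crossing 0 y j -> last_crossing 0 x j.
have /near_all_seq nQ : forall j, j \in map Posz (iota 0 M) ->
    \forall y \near x, Q j y.
  move=> j _; have gcont : continuous (zpow g j) by exact: zpow_continuous.
  have [Lj|nLj] := pselect (last_crossing 0 x j); first by near=> y.
  have [jd|jd] := leP 0 (j + d (zpow g j x)).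
    near=> y => -[]; rewrite (_ : d (zpow g j y) = d (zpow g j x)) 1?ltNge ?jd//.
    by near: y; exact: (locally_constant_comp d_loc gcont x).
  have [n js] : exists n, ~ 0 <= j + s n (zpow g j x).
    by apply/existsNP => js; exact: nLj.
  near=> y => -[_ /(_ n)]; rewrite (_ : s n (zpow g j y) = s n (zpow g j x)) //.
  by near: y; exact: (locally_constant_comp (s_loc n) gcont x).
near=> y => j; rewrite !mem_filter => /andP[/asboolP Lj jM].
by rewrite jM andbT; apply/asboolP; move: j jM Lj; near: y.
Unshelve. all: by end_near. Qed.

Lemma size_crossings_const x y : size (crossings x) = size (crossings y).
Proof.
suff le x' y' : (size (crossings x') <= size (crossings y'))%N.
  by apply/eqP; rewrite eqn_leq !le.
pose K := [set z | size (crossings x') <= size (crossings z)]%N.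
suff KT : K = setT by have : K y' by rewrite KT.
apply: contrapT => Ky'; suff K0 : K = set0.
  by have : K x' := leqnn _; rewrite K0.
case: gmin => _ _ _ [_]; apply.
- rewrite -[K]setCK; apply: open_closedC; rewrite openE => z /= nKz.
  have := near_crossings_sub z; apply: filterS => w.
  move=> /(uniq_leq_size (crossings_uniq w)) wz Kw.
  by apply: nKz; exact: leq_trans wz.
- by split=> // sub; apply: Ky'; exact/seteqP.
- by move=> _ [z Kz <-]; exact: leq_trans (size_crossings_le z).
Qed.

(** The inclusion of [near_crossings_sub] is between duplicate-free lists of equal length. *)
Lemma near_crossings_eq x : \forall y \near x, crossings y =i crossings x.
Proof.
have := near_crossings_sub x; apply: filterS => y sub.
have := uniq_min_size (crossings_uniq y) sub.
by rewrite (size_crossings_const x y) leqnn => /(_ isT)[].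
Qed.

(** Otherwise [w] is the lowest point of its [h]-orbit. Then no orbit counted at [w] passes through
    [w], so all its crossings survive at [g w], and the orbit of [w] adds [c w], against
    [size_crossings_const]. *)
Lemma aperiodic_no_minimum w : ~ periodic h w -> (forall n, 0 <= s n w) ->
  exists n, s n (iter n (homeoV h) w) > 0.
Proof.
move=> nper w0; apply: contrapT => nbelow.
have notback m j : last_crossing 0 w j -> iter m h (zpow g j w) <> w.
  move=> [jd js] e; apply: nbelow; exists m.+1.
  have -> : iter m.+1 (homeoV h) w = homeoV h (zpow g j w).
    by rewrite iterS -(iter_homeoK h m (zpow g j w)) e.
  set v := zpow g j w in jd js e *.
  have hv : h (homeoV h v) = v := homeo_invK h v.
  have := sD m 1 (homeoV h v); rewrite addn1 s1 /= hv => ->.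
  have -> : c (homeoV h v) = - d v by rewrite /d opprK.
  suff : s m v + j = 0 by lia.
  by apply: (@ginj w); rewrite zpowD -iter_cocycle.
have sub : {subset c w :: crossings w <= [seq j + 1 | j <- crossings (g w)]}.
  move=> j jw; apply/mapP; exists (j - 1); last by rewrite subrK.
  rewrite mem_crossings; apply/asboolP/last_crossing_shift.
  rewrite subrK; move: jw; rewrite inE => /predU1P[->|].
    exact: last_crossing_from_min.
  rewrite mem_crossings => /asboolP Lj; apply: last_crossing_nohit => //.
  by case=> m /(notback _ _ Lj).
suff /uniq_leq_size /(_ sub) : uniq (c w :: crossings w).
  by rewrite size_map (size_crossings_const (g w) w) ltnn.
rewrite /= crossings_uniq andbT mem_crossings; apply/asboolP => -[].
by rewrite -hc dh; lia.
Qed.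

(** With both ends going up, the orbit is bounded below and so has a lowest point [w], which
    [aperiodic_no_minimum] rules out. *)
Lemma aperiodic_no_return x : ~ periodic h x ->
  escapes g h x -> escapes g (homeoV h) x -> False.
Proof.
move=> nper /escapes_cocycle /(_ 0) [N fwd] /(_ 0) [N' bwd].
have [b sb] := @eventually_ge0_bounded_below (s^~ x) N fwd.
pose u n := - s n (iter n (homeoV h) x).
have uE n : iter n (homeoV h) x = zpow g (u n) x.
  have := iter_homeoK (homeoV h) n x.
  rewrite (_ : iter n (homeoV (homeoV h)) = iter n h) //.
  rewrite iter_cocycle => e; by rewrite -[in RHS]e -zpowD /u addNr.
have [b' ub] : exists b', forall n, b' <= u n.
  apply: (@eventually_ge0_bounded_below u N') => n /bwd [t t0].
  by rewrite uE => /ginj ->.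
pose Q k := exists n : int, zpow h n x = zpow g k x.
have [k [a ak] kmin] : exists2 k, Q k & forall j, Q j -> k <= j.
  apply: (@int_minimum Q (Order.min b b') 0); first by exists 0.
  move=> j [[n|n]]; rewrite ge_min.
    by rewrite [LHS]iter_cocycle => /ginj <-; rewrite sb.
  by rewrite [LHS]uE => /ginj <-; rewrite ub orbT.
set w := zpow h a x in ak.
have w0 n : 0 <= s n w.
  suff /kmin : Q (s n w + k) by lia.
  by exists (n%:Z + a); rewrite !zpowD -ak -iter_cocycle.
have [|m] := aperiodic_no_minimum _ w0; first by move/periodic_zpow.
set v := iter m (homeoV h) w => sv.
suff /kmin : Q (- s m v + k) by lia.
exists (- m%:Z + a); rewrite zpowD -zpowV -[zpow (homeoV h) m _]/v zpowD -ak.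
have -> : w = zpow g (s m v) v.
  by rewrite -iter_cocycle; exact: esym (iter_homeoK (homeoV h) m w).
by rewrite -zpowD addNr.
Qed.

(** The orbit of [x] makes its last crossing of level 1 at some time [m + 1]. The crossings at [g x]
    are locally constant, so a nearby [y] crosses at the same time; it is then aperiodic and cannot
    escape downwards. *)
Lemma escapes_open : open [set x | escapes g h x].
Proof.
rewrite openE => x /= /escapes_cocycle esc.
(* With threshold 1 rather than 0, time 0 already counts as a visit below, so there is a visit to
   maximize over. *)
have [N sN] := esc 1.
have [||m sm mmax] := @ex_maxnP (fun n => s n x < 1) N.
- by exists 0%N; rewrite s0.
- by move=> n; apply: contraTT; rewrite -ltnNge -leNgt => /ltnW /sN.
have Lx : last_crossing 1 x (s m.+1 x).
  have sS n : s n.+1 x = s n x + c (iter n h x).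
    by have := sD 1 n x; rewrite add1n s1.
  split; rewrite -iter_cocycle /=; first by rewrite dh sS; lia.
  move=> n; rewrite -[h _]/(iter m.+1 h x) -sD leNgt; apply/negP => /mmax; lia.
have near_s : \forall y \near x, s m.+1 y = s m.+1 x := s_loc m.+1 x.
have near_c : \forall y \near x, crossings (g y) =i crossings (g x).
  exact: (homeo_fun_continuous (h := g) (near_crossings_eq (g x))).
near=> y.
have Ly : last_crossing 1 y (s m.+1 y).
  rewrite (_ : s m.+1 y = s m.+1 x - 1 + 1); last by rewrite subrK; near: y.
  apply/last_crossing_shift/asboolP; rewrite -mem_crossings.
  rewrite (_ : crossings (g y) =i crossings (g x)); last by near: y.
  by rewrite mem_crossings; apply/asboolP/last_crossing_shift; rewrite subrK.
have nper : ~ periodic h y.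
  move/(periodic_iter h m.+1 y).2; rewrite iter_cocycle.
  exact: last_crossing_aperiodic Ly.
have [//|/escapesV_cocycle /(_ 0) [N' sN']] := aperiodic_escapes nper.
have := Ly.2 N'; rewrite -iter_cocycle -sD.
by have := sN' (N' + m.+1)%N (leq_addr _ _); lia.
Unshelve. all: by end_near. Qed.

Lemma fixed_open n : open [set x | iter n h x = x].
Proof.
rewrite openE => x /= e.
have sx : s n x = 0 by apply: (@ginj x); rewrite -iter_cocycle e.
by apply: filterS (s_loc n x) => y sy; rewrite /= iter_cocycle sy sx.
Qed.

Lemma periodic_open : open [set x | periodic h x].
Proof.
rewrite (_ : mkset _ = \bigcup_(n in setT) [set x | iter n.+1 h x = x]).
  by apply: bigcup_open => n _; exact: fixed_open.
by apply/seteqP; split=> x; [move=> [n e]; exists n|move=> [n _ e]; exists n].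
Qed.

End Cocycle.

(** * Escape directions for members of the full group *)

Section FullGroup.
Variables (X : topologicalType) (g h : homeo X).
Hypotheses (gmin : compact_minimal_system g) (hg : topological_full_group g h).

Lemma full_group_escapes x : ~ periodic h x ->
  escapes g h x \/ escapes (homeoV g) h x.
Proof.
case: hg => c cl hc; case: gmin => _ cX _ _.
have [M cM] := locally_constant_bounded cX cl.
exact: aperiodic_escapes gmin hc M cM x.
Qed.

Lemma full_group_no_return x : ~ periodic h x ->
  escapes g h x -> escapes g (homeoV h) x -> False.
Proof.
case: hg => c cl hc; case: gmin => _ cX _ _.
have [M cM] := locally_constant_bounded cX cl.
exact: aperiodic_no_return gmin cl hc M cM x.
Qed.

Lemma full_group_escapes_open : open [set x | escapes g h x].
Proof.
case: hg => c cl hc; case: gmin => _ cX _ _.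
have [M cM] := locally_constant_bounded cX cl.
exact: escapes_open gmin cl hc M cM.
Qed.

Lemma full_group_periodic_open : open [set x | periodic h x].
Proof. by case: hg => c cl hc; exact: periodic_open gmin cl hc. Qed.

Lemma escapes_aperiodic x : escapes g h x -> ~ periodic h x.
Proof.
move=> /(_ 1) [N esc] [n e].
have [t t1] := esc (N * n.+1)%N (leq_pmulr _ (ltn0Sn n)).
rewrite iter_period // => /(@minimal_aperiodic _ _ gmin x 0 t); lia.
Qed.

Lemma escapes_exclusive x : escapes g h x -> escapes (homeoV g) h x -> False.
Proof.
move=> /(_ 1) [N esc] /(_ 1) [N' esc'].
have [t t1 et] := esc (maxn N N') (leq_maxl _ _).
have [t' t'1] := esc' (maxn N N') (leq_maxr _ _).
by rewrite et zpowV => /(@minimal_aperiodic _ _ gmin x); lia.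
Qed.

Lemma escapes_iter n x : escapes g h (iter n h x) <-> escapes g h x.
Proof.
have [c _ hc] := hg.
have en := iter_cocycle hc n x; set s := \sum_(_ < _) _ in en.
split=> esc p.
  have [N Nesc] := esc (p - s); exists (N + n)%N => m Nm.
  have [|t pt] := Nesc (m - n)%N; first lia.
  rewrite -iterD subnK; last by lia.
  by rewrite en -zpowD => ->; exists (t + s) => //; lia.
have [N Nesc] := esc (p + s); exists N => m Nm.
have [t pt et] := Nesc (m + n)%N (leq_trans Nm (leq_addr _ _)).
exists (t - s); first lia.
by rewrite -iterD et en -zpowD subrK.
Qed.

Lemma escapes_zpow n x : escapes g h (zpow h n x) <-> escapes g h x.
Proof.
case: n => n; first exact: escapes_iter.
rewrite -(escapes_iter n.+1 (zpow h (Negz n) x)).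
rewrite (_ : iter n.+1 h _ = x) //; exact: (iter_homeoK (homeoV h) n.+1 x).
Qed.

Lemma lt_orb_zpow (x : X) (j k : int) :
  lt_orb g (zpow g j x) (zpow g k x) <-> j < k.
Proof.
have ginj := @minimal_aperiodic _ _ gmin x.
split=> [[[t]]|jk].
  rewrite -zpowD => /ginj -> ne.
  suff /eqP : t%:Z <> 0 by lia.
  by move=> t0; apply: ne; rewrite t0 add0r.
split; last by move/ginj; lia.
by exists `|k - j|%N; rewrite -zpowD; congr (zpow g _ x); lia.
Qed.


End FullGroup.

(** * Positive orbits are the escaping ones *)

Section PositiveOrbits.
Variables (X : topologicalType) (g h : homeo X).
Hypotheses (gmin : compact_minimal_system g) (hg : topological_full_group g h).

Lemma zpow_full_group (n : int) (x : X) :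
  exists k : int, zpow h n x = zpow g k x.
Proof.
have [c _ hc] := hg; have [d _ hd] := topological_full_groupVr hg.
case: n => n.
  by exists (\sum_(i < n) c (iter i h x)); exact: iter_cocycle.
by exists (\sum_(i < n.+1) d (iter i (homeoV h) x)); exact: iter_cocycle.
Qed.

(** The inverse of [h] is in the full group too, so the backward orbit escapes one way;
    [full_group_no_return] excludes upwards. *)
Lemma escapes_backward x : escapes g h x -> escapes (homeoV g) (homeoV h) x.
Proof.
move=> esc; have nper := escapes_aperiodic gmin esc.
have [||//] := full_group_escapes gmin (topological_full_groupVr hg) (x := x).
- move=> [n e]; apply: nper; exists n.
  by rewrite -[in LHS]e; exact: (iter_homeoK (homeoV h) n.+1 x).
- by move=> /(full_group_no_return gmin hg nper esc).
Qed.

(** Positivity with both points equal to [x] already excludes periodicity and downward escape.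
    Conversely, [escapes_backward] controls the other end, and any point of the orbit sits at a
    finite level [k]. *)
Lemma union_positive_escapes : union_positive g h = [set x | escapes g h x].
Proof.
apply/seteqP; split=> x /=.
  move=> [O [_ pos] Ox]; have {O Ox pos} [n pos] := pos x x Ox Ox.
  have lt0 m k : (n <= m)%N -> iter m h x = zpow g k x -> 0 < k.
    move=> /pos [xm _] e; apply/(lt_orb_zpow gmin x 0 k).
    by rewrite -e.
  have nper : ~ periodic h x.
    move=> [k e]; have := @lt0 (n * k.+1)%N 0 (leq_pmulr _ (ltn0Sn k)).
    by rewrite iter_period // => /(_ erefl).
  case: (full_group_escapes gmin hg nper) => // /(_ 1) [N esc].
  have [t t1] := esc (maxn n N) (leq_maxr _ _).
  by rewrite zpowV => /(lt0 _ _ (leq_maxl _ _)); lia.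
move=> esc; exists (orb h x); last by exists 0.
split; first by exists x.
move=> y z [a _ ay] [b _ bz].
have escy : escapes g h y by rewrite -ay; exact/(escapes_zpow hg).
have [k zk] : exists k : int, z = zpow g k y.
  have [k e] := zpow_full_group (b - a) y; exists k.
  by rewrite -e -ay -zpowD subrK bz.
(* The margins of 1 make the inequalities strict; for the inverse of [g], level [k] reads [- k]. *)
have [N fwd] := escy (k + 1).
have [N' bwd] := escapes_backward escy (1 - k).
exists (maxn N N') => n; rewrite geq_max => /andP[/fwd [t tk et] /bwd [t' tk' et']].
split.
  by rewrite [zpow h n y]et zk; apply/(lt_orb_zpow gmin); lia.
rewrite -zpowV [zpow (homeoV h) n y]et' zpowV zk; apply/(lt_orb_zpow gmin); lia.
Qed.

End PositiveOrbits.

(** * A uniform period, and the partition *)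

Lemma finite_order_on_periodic (X : topologicalType) (h : homeo X) :
  compact [set: X] -> open [set x | periodic h x] ->
  closed [set x | periodic h x] -> (forall n, open [set x | iter n h x = x]) ->
  finite_order_on h [set x | periodic h x].
Proof.
move=> cX perO perC fixO.
(* A period of a point works for its neighbours, as fixed sets are open; near an aperiodic point the
   implication is vacuous. *)
have [] := @compact_nat_cover X (fun n x => periodic h x ->
    exists2 k, (0 < k <= n)%N & iter k h x = x) cX.
- move=> m n x mn U /U [k /andP[k0 km] e]; exists k => //.
  by rewrite k0 (leq_trans km).
- move=> x; have [[n e]|nper] := pselect (periodic h x).
    exists n.+1; have : \forall y \near x, iter n.+1 h y = y.
      by apply: open_nbhs_nbhs; split=> //; exact: fixO.
    by apply: filterS => y ey _; exists n.+1 => //=.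
  exists 0%N; have : \forall y \near x, ~ periodic h y.
    by apply: open_nbhs_nbhs; split=> //; exact: closed_openC.
  by apply: filterS.
(* Each periodic point has a period at most [N], so the factorial is a common multiple. *)
move=> N U; exists N`!; first exact: fact_gt0.
move=> x /U [k kN e]; have /dvdnP[q ->] : (k %| N`!)%N by exact: dvdn_fact.
exact: iter_period.
Qed.

Local Close Scope ring_scope.

Theorem theorem1p2 (X : topologicalType) (g h : homeo X)
    (gmin : compact_minimal_system g) (hg : topological_full_group g h) :
  exists Xpos Xneg Xper : set X,
    [/\ Xpos `|` Xneg `|` Xper = [set: X],
        [/\ Xpos `&` Xneg = set0, Xpos `&` Xper = set0 & Xneg `&` Xper = set0],
        [/\ clopen Xpos, clopen Xneg & clopen Xper],
        [/\ cyclic_invariant h Xpos, cyclic_invariant h Xneg &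
            cyclic_invariant h Xper] &
        [/\ Xpos = union_positive g h, Xneg = union_negative g h &
            finite_order_on h Xper]].
Proof.
(* Negative orbits are handled as positive orbits for the inverse of [g]. *)
have gVmin := compact_minimal_systemV gmin.
have hgV := topological_full_groupVl hg.
pose P := [set x | escapes g h x]; pose N := [set x | escapes (homeoV g) h x].
pose F := [set x | periodic h x].
have PNF : P `|` N `|` F = setT.
  apply/seteqP; split=> // x _.
  by have [|/(full_group_escapes gmin hg)] := pselect (periodic h x);
    [right|left].
have PN : P `&` N = set0.
  by apply/seteqP; split=> // x [/= p /(escapes_exclusive gmin p)].
have PF : P `&` F = set0.
  by apply/seteqP; split=> // x [/= /(escapes_aperiodic gmin)].
have NF : N `&` F = set0.
  by apply/seteqP; split=> // x [/= /(escapes_aperiodic gVmin)].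
have Po : open P := full_group_escapes_open gmin hg.
have No : open N := full_group_escapes_open gVmin hgV.
have Fo : open F := full_group_periodic_open gmin hg.
(* Openness of the three pieces suffices, each being the complement of the other two. *)
have clopen_third (A B C : set X) : A `|` B `|` C = setT ->
    A `&` B = set0 -> A `&` C = set0 -> open A -> open B -> open C -> clopen A.
  move=> ABC AB AC Ao Bo Co; split=> //.
  suff -> : A = ~` (B `|` C) by apply: open_closedC; exact: openU.
  apply/seteqP; split=> x.
    move=> Ax [Bx|Cx]; first by have : (A `&` B) x by []; rewrite AB.
    by have : (A `&` C) x by []; rewrite AC.
  move=> /not_orP[nB nC].
  by have [[//|/nB]|/nC] : (A `|` B `|` C) x by rewrite ABC.
have Fc : clopen F.
  apply: (clopen_third F P N) => //; [|by rewrite setIC..].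
  by rewrite -setUA setUC.
exists P, N, F; split=> //.
- split=> //; first exact: clopen_third PNF PN PF Po No Fo.
  apply: (clopen_third N P F) => //; last by rewrite setIC.
  by rewrite [N `|` P]setUC.
- split=> n _ [x /= Px <-] /=.
  + exact/(escapes_zpow hg).
  + exact/(escapes_zpow hgV).
  + exact/periodic_zpow.
- split; first exact/esym/union_positive_escapes.
    exact/esym/(union_positive_escapes gVmin hgV).
  have [_ cX _ _] := gmin; case: Fc => _ Fcl.
  apply: finite_order_on_periodic => // n; case: hg => c cl hc.
  exact: fixed_open gmin cl hc n.
Qed.
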